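(* If $(x^\star,\lambda^\star,\mu^\star)$ is a KKT triple of (P) satisfying LICQ and SOSC, then $\Psi(\lambda^\star)$ is the same regardless of which of the algorithms (block coordinate descent, generalized Benders decomposition, ADMM, successive convex approximation, interior-point methods, mirror descent, Frank--Wolfe, Riemannian gradient descent) produced it; that is, any two algorithms whose limits are KKT triples of (P) with the same primal point $x^\star$ yield inequality multiplier vectors with the same label under $\Psi$.
   Context: Problem (P): minimize $f(x)$ over $x\in\mathbb{R}^n$ subject to $g_i(x)\le0$ ($i=1,\dots,m$), $h_j(x)=0$ ($j=1,\dots,p$), with $f,g_i,h_j$ of class $C^2$. Lagrangian: $\mathfrak{L}(x,\lambda,\mu)=f(x)+\sum_i\lambda_ig_i(x)+\sum_j\mu_jh_j(x)$. A KKT triple $(x^\star,\lambda^\star,\mu^\star)\in\mathbb{R}^n\times\mathbb{R}^m_+\times\mathbb{R}^p$ satisfies $\nabla_x\mathfrak{L}=0$; $g_i\le0$, $\lambda_i^\star\ge0$, $\lambda_i^\star g_i=0$ for all $i$; $h_j=0$ for all $j$ (at $x^\star$). $\mathcal{A}(x^\star)=\{i:g_i(x^\star)=0\}$. LICQ: $\{\nabla g_i(x^\star)\}_{i\in\mathcal{A}(x^\star)}\cup\{\nabla h_j(x^\star)\}_j$ linearly independent. SOSC: $d^\top\nabla^2_{xx}\mathfrak{L}\,d>0$ for every nonzero $d$ with $\nabla g_i(x^\star)^\top d\le0$ for all $i\in\mathcal{A}(x^\star)$, $\nabla g_i(x^\star)^\top d=0$ for all $i$ with $\lambda_i^\star\neq0$,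 $\nabla h_j(x^\star)^\top d=0$ for all $j$. For $\lambda\in\mathbb{R}^m_+$ let $L(\lambda)=\sum_i\lambda_i$; $\bar\lambda=\lambda/L(\lambda)$ if $L(\lambda)>0$, $\bar\lambda=0$ otherwise; $\bar\lambda_{(1)}\ge\cdots\ge\bar\lambda_{(m)}$ the sorted entries. Fix $\Theta=(\delta,\theta,\gamma,k)$ with $0<\delta<\tfrac12$, $\theta\in(\tfrac12,1)$, $\gamma\in(0,1)$, $k\in\{1,\dots,m-1\}$. $\Sigma_k(\lambda)=\sum_{j=1}^k\bar\lambda_{(j)}$, $\sigma_\delta(\lambda)=\frac1m|\{i:\bar\lambda_i>\delta\}|$, $\tau(\lambda)=\bar\lambda_{(2)}$. Core regimes in $\mathbb{R}^m_+$: $\mathcal{R}_{\mathrm{unc}}^\circ=\{L<\delta\}$; $\mathcal{R}_{\mathrm{res}}^\circ=\{L>\delta,\Sigma_k>\theta\}$; $\mathcal{R}_{\mathrm{sat}}^\circ=\{L>\delta,\Sigma_k<\theta,\sigma_\delta>\gamma\}$; $\mathcal{R}_{\mathrm{coup}}^\circ=\{L>\delta,\Sigma_k<\theta,\sigma_\delta<\gamma,\tau>\delta\}$. $\Psi(\lambda)$ is the unique $r\in\{\mathrm{unc},\mathrm{res},\mathrm{sat},\mathrm{coup}\}$ with $\lambda\in\mathcal{R}_r^\circ$ if it exists, and $\mathrm{hyb}$ otherwise. An algorithm ''produces'' a KKT triple if that triple is the limit of its primal-dual iterates. *)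

(* Defs.v *)
From mathcomp Require Import all_boot all_order all_algebra.
From mathcomp Require Import all_classical all_reals all_analysis.

Set Implicit Arguments.
Unset Strict Implicit.
Unset Printing Implicit Defensive.

Import Order.TTheory GRing.Theory Num.Theory.
Import numFieldNormedType.Exports.

Local Open Scope classical_set_scope.
Local Open Scope ring_scope.

Section Calculus.
Context {R : realType} {n : nat}.
Implicit Types (F : 'cV[R]_n -> R) (x : 'cV[R]_n).

Definition basis_vec (i : 'I_n) : 'cV[R]_n := delta_mx i 0.

Definition partial (i : 'I_n) F : 'cV[R]_n -> R :=
  fun x => 'D_(basis_vec i) F x.

(* Class C^k on all of R^n: partial derivatives up to order k exist and are
   continuous.  The existence clause matters because 'D is a total operator. *)
Fixpoint class_C (k : nat) F : Prop :=
  continuous F /\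
  if k is k'.+1 then
    forall i, (forall x, derivable F x (basis_vec i)) /\ class_C k' (partial i F)
  else True.

Definition grad F x : 'cV[R]_n := \col_i partial i F x.

Definition hess F x : 'M[R]_n := \matrix_(i, j) partial i (partial j F) x.

End Calculus.

Record problem (R : realType) (n m p : nat) := Problem {
  objective : 'cV[R]_n -> R;
  ineq : 'I_m -> 'cV[R]_n -> R;
  eqn : 'I_p -> 'cV[R]_n -> R }.

Section Optimality.
Context {R : realType} {n m p : nat}.
Variable P : problem R n m p.
Local Notation f := (objective P).
Local Notation g := (ineq P).
Local Notation h := (eqn P).
Implicit Types (x : 'cV[R]_n) (l : 'cV[R]_m) (mu : 'cV[R]_p).

Definition C2_problem : Prop :=
  [/\ class_C 2 f, forall i, class_C 2 (g i) & forall j, class_C 2 (h j)].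

Definition lagrangian x l mu : R :=
  f x + \sum_(i < m) l i 0 * g i x + \sum_(j < p) mu j 0 * h j x.

Definition KKT x l mu : Prop :=
  [/\ grad (fun y => lagrangian y l mu) x = 0,
      forall i, [/\ g i x <= 0, 0 <= l i 0 & l i 0 * g i x = 0] &
      forall j, h j x = 0].

Definition active x : {set 'I_m} := [set i | g i x == 0]%SET.

(* The gradients are taken as an indexed family: a repeated gradient violates
   the condition. *)
Definition LICQ x : Prop :=
  free ([seq grad (g i) x | i in active x] ++ [seq grad (h j) x | j : 'I_p]).

Definition critical_direction x l (d : 'cV[R]_n) : Prop :=
  [/\ forall i, i \in active x -> ((grad (g i) x)^T *m d) 0 0 <= 0,
      forall i, l i 0 != 0 -> ((grad (g i) x)^T *m d) 0 0 = 0 &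
      forall j, ((grad (h j) x)^T *m d) 0 0 = 0].

Definition SOSC x l mu : Prop :=
  forall d : 'cV[R]_n, d != 0 -> critical_direction x l d ->
    0 < (d^T *m hess (fun y => lagrangian y l mu) x *m d) 0 0.

End Optimality.

Record thresholds (R : realType) := Thresholds {
  t_delta : R; t_theta : R; t_gamma : R; t_k : nat }.

Definition valid_thresholds (R : realType) (m : nat) (T : thresholds R) : Prop :=
  [/\ 0 < t_delta T < 2^-1, 2^-1 < t_theta T < 1, 0 < t_gamma T < 1
    & (1 <= t_k T <= m.-1)%N].

Inductive core_regime := unc | res | sat | coup.

Inductive regime := Core of core_regime | hyb.

Section Label.
Context {R : realType} {m : nat}.
Variable T : thresholds R.
Implicit Types l : 'cV[R]_m.

Definition total l : R := \sum_(i < m) l i 0.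

Definition lbar l : 'cV[R]_m := if 0 < total l then (total l)^-1 *: l else 0.

(* Nonincreasing, and indexed from 0. *)
Definition lbar_sorted l : seq R := sort >=%O [seq lbar l i 0 | i : 'I_m].

Definition Sigma_k l : R := \sum_(j < t_k T) (lbar_sorted l)`_j.

Definition sigma_delta l : R :=
  #|[set i | t_delta T < lbar l i 0]%SET|%:R / m%:R.

Definition tau l : R := (lbar_sorted l)`_1.

(* Meant for entrywise nonnegative [l], as KKT multipliers are. *)
Definition in_core (r : core_regime) l : Prop :=
  match r with
  | unc => total l < t_delta T
  | res => t_delta T < total l /\ t_theta T < Sigma_k l
  | sat => [/\ t_delta T < total l, Sigma_k l < t_theta T
             & t_gamma T < sigma_delta l]
  | coup => [/\ t_delta T < total l, Sigma_k l < t_theta T,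
                sigma_delta l < t_gamma T & t_delta T < tau l]
  end.

(* [cid] extracts the regime from the proof that it exists and is unique. *)
Definition Psi l : regime :=
  if pselect (exists! r, in_core r l) is left e then Core (sval (cid e))
  else hyb.

End Label.

Inductive algorithm :=
  | block_coordinate_descent
  | generalized_Benders
  | ADMM
  | successive_convex_approximation
  | interior_point
  | mirror_descent
  | Frank_Wolfe
  | Riemannian_gradient_descent.

Definition primal_dual (R : realType) (n m p : nat) : Type :=
  ('cV[R]_n * 'cV[R]_m * 'cV[R]_p)%type.

(* The primal-dual sequences each algorithm may generate on a problem, over all
   its initializations, parameters and internal choices.  No update rule is
   imposed: results are stated for every such assignment, hence in particular
   for the one given by the actual update rules. *)
Definition execution_model (R : realType) (n m p : nat) : Type :=
  algorithm -> problem R n m p -> set (nat -> primal_dual R n m p).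

Definition produces (R : realType) (n m p : nat) (runs : execution_model R n m p)
    (a : algorithm) (P : problem R n m p)
    (x : 'cV[R]_n) (l : 'cV[R]_m) (mu : 'cV[R]_p) : Prop :=
  exists2 u : nat -> primal_dual R n m p,
    runs a P u & u k @[k --> \oo] --> (x, l, mu).

(* Main.v *)
Require Import Defs.
From mathcomp Require Import all_boot all_order all_algebra.
From mathcomp Require Import all_classical all_reals all_analysis.

(** At a point where LICQ holds there is only one vector of KKT multipliers, so
    the label, being a function of that vector, cannot depend on the sequence
    which converges to it.  Stationarity says that [- grad f x] is the
    combination of the constraint gradients whose coefficients are the
    multipliers ([KKT_stationarity]).  Complementary slackness kills the
    coefficients of the inactive constraints, so the difference of two multiplier
    pairs gives a linear relation between the gradients of the active and of the
    equality constraints only, and LICQ makes this relation trivial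
    ([KKT_multipliers_unique]). *)

Set Implicit Arguments.
Unset Strict Implicit.
Unset Printing Implicit Defensive.

Import Order.TTheory GRing.Theory Num.Theory.
Import numFieldNormedType.Exports.

Local Open Scope classical_set_scope.
Local Open Scope ring_scope.

(** [free] speaks of a sequence of vectors through its positions, whereas a
    relation between constraint gradients is indexed by the constraints; this
    form passes from one to the other without numbering the constraints. *)
Lemma free_map_coef0 (K : fieldType) (V : vectType K) (I : eqType) (s : seq I)
    (F : I -> V) (c : I -> K) :
  free (map F s) -> \sum_(i <- s) c i *: F i = 0 -> {in s, forall i, c i = 0}.
Proof.
elim: s => [//|i s IHs] /=; rewrite free_cons => /andP[Fi_notin free_s].
rewrite big_cons => sum0.
have sum_in : \sum_(j <- s) c j *: F j \in <<map F s>>%VS.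
  rewrite big_seq; apply: rpred_sum => j j_s.
  by rewrite rpredZ// memv_span// map_f.
have ci0 : c i = 0.
  apply/eqP; apply: contraNT Fi_notin => ci_neq0.
  move/eqP: sum0; rewrite addr_eq0 => /eqP ciFi.
  by rewrite -(scalerK ci_neq0 (F i)) ciFi rpredZ// rpredN.
move: sum0; rewrite ci0 scale0r add0r => /(IHs free_s) cs0 j.
by rewrite inE => /predU1P[->//|/cs0].
Qed.

Section Gradient.
Context {R : realType} {n : nat}.
Implicit Types (F G : 'cV[R]_n -> R) (x : 'cV[R]_n).

Definition has_partials F x := forall i, derivable F x (basis_vec i).

Lemma class_C_has_partials k F x : class_C k.+1 F -> has_partials F x.
Proof. by move=> [_ dF] i; have [] := dF i. Qed.

Lemma gradD F G x : has_partials F x -> has_partials G x ->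
  grad (F \+ G) x = grad F x + grad G x.
Proof.
by move=> dF dG; apply/colP => i; rewrite !mxE /partial deriveD.
Qed.

Lemma has_partialsD F G x : has_partials F x -> has_partials G x ->
  has_partials (F \+ G) x.
Proof. by move=> dF dG i; apply: derivableD. Qed.

Lemma comb_fctE k (c : 'I_k -> R) (F : 'I_k -> 'cV[R]_n -> R) :
  (fun y => \sum_(j < k) c j * F j y) = \sum_(j < k) c j *: F j.
Proof. by rewrite fct_sumE. Qed.

Lemma has_partials_comb k (c : 'I_k -> R) (F : 'I_k -> 'cV[R]_n -> R) x :
  (forall j, has_partials (F j) x) ->
  has_partials (fun y => \sum_(j < k) c j * F j y) x.
Proof.
move=> dF i.
by rewrite comb_fctE; apply: derivable_sum => j; apply: derivableZ; apply: dF.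
Qed.

Lemma grad_comb k (c : 'I_k -> R) (F : 'I_k -> 'cV[R]_n -> R) x :
  (forall j, has_partials (F j) x) ->
  grad (fun y => \sum_(j < k) c j * F j y) x = \sum_(j < k) c j *: grad (F j) x.
Proof.
move=> dF; apply/colP => i; rewrite summxE !mxE /partial.
rewrite comb_fctE derive_sum; last by move=> j; apply: derivableZ; apply: dF.
by apply: eq_bigr => j _; rewrite deriveZ ?mxE//; apply: dF.
Qed.

End Gradient.

Section Multipliers.
Context {R : realType} {n m p : nat}.
Variable P : problem R n m p.
Implicit Types (x : 'cV[R]_n) (l : 'cV[R]_m) (mu : 'cV[R]_p).

Lemma KKT_stationarity x l mu : C2_problem P -> KKT P x l mu ->
  \sum_(i < m) l i 0 *: grad (ineq P i) x
    + \sum_(j < p) mu j 0 *: grad (Defs.eqn P j) x = - grad (objective P) x.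
Proof.
move=> [/(class_C_has_partials (x := x)) df Cg Ch] [grad0 _ _].
have dg i := class_C_has_partials (x := x) (Cg i).
have dh j := class_C_has_partials (x := x) (Ch j).
have dsg := has_partials_comb (c := fun i => l i 0) dg.
have dsh := has_partials_comb (c := fun j => mu j 0) dh.
apply/eqP; rewrite -addr_eq0 addrC addrA -!grad_comb//.
move: grad0 <-; apply/eqP.
rewrite -!gradD//; exact: has_partialsD.
Qed.

Lemma KKT_inactive x l mu i : KKT P x l mu -> i \notin active P x -> l i 0 = 0.
Proof.
move=> [_ feas _]; rewrite inE => gi_neq0.
have [_ _ /eqP] := feas i.
by rewrite mulf_eq0 (negbTE gi_neq0) orbF => /eqP.
Qed.

Lemma KKT_multipliers_unique x l1 l2 mu1 mu2 : C2_problem P -> LICQ P x ->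
  KKT P x l1 mu1 -> KKT P x l2 mu2 -> l1 = l2 /\ mu1 = mu2.
Proof.
move=> C2 licq kkt1 kkt2.
(* A single coefficient function on the tagged union of the two index sets
   lets the concatenated family of LICQ be treated as one indexed family. *)
pose G (s : 'I_m + 'I_p) :=
  match s with inl i => grad (ineq P i) x | inr j => grad (Defs.eqn P j) x end.
pose c (s : 'I_m + 'I_p) :=
  match s with inl i => l1 i 0 - l2 i 0 | inr j => mu1 j 0 - mu2 j 0 end.
pose s := map inl (enum (active P x)) ++ map inr (enum 'I_p).
have free_s : free (map G s).
  by rewrite map_cat -(map_comp G inl) -(map_comp G inr); exact: licq.
have inactive0 i : i \notin active P x -> l1 i 0 - l2 i 0 = 0.
  by move=> iNA; rewrite (KKT_inactive kkt1)// (KKT_inactive kkt2)// subrr.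
have sum0 : \sum_(t <- s) c t *: G t = 0.
  (* Inactive coefficients vanish, so the sum over the active set extends to all
     inequality constraints, where both stationarity equations apply. *)
  rewrite big_cat !big_map /= !big_enum /=.
  rewrite big_mkcond /= (eq_bigr (fun i => l1 i 0 *: grad (ineq P i) x
                                    - l2 i 0 *: grad (ineq P i) x)); last first.
    move=> i _; rewrite -scalerBl.
    by case: ifPn => // /inactive0 ->; rewrite scale0r.
  rewrite [X in _ + X](eq_bigr (fun j => mu1 j 0 *: grad (Defs.eqn P j) x
                            - mu2 j 0 *: grad (Defs.eqn P j) x)); last first.
    by move=> j _; rewrite scalerBl.
  rewrite !sumrB addrACA -opprD.
  by rewrite (KKT_stationarity C2 kkt1) (KKT_stationarity C2 kkt2) subrr.
have c0 := free_map_coef0 free_s sum0.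
split; apply/colP => i; apply/eqP; rewrite -subr_eq0; apply/eqP.
  have [iA|/inactive0//] := boolP (i \in active P x).
  by apply: (c0 (inl i)); rewrite mem_cat map_f// mem_enum.
by apply: (c0 (inr i)); rewrite mem_cat (map_f inr) ?orbT// mem_enum.
Qed.

End Multipliers.

Theorem corollary4 (R : realType) (n m p : nat) (P : problem R n m p)
    (T : thresholds R) (runs : execution_model R n m p)
    (x : 'cV[R]_n) (l : 'cV[R]_m) (mu : 'cV[R]_p) :
  C2_problem P -> valid_thresholds m T ->
  KKT P x l mu -> LICQ P x -> SOSC P x l mu ->
  forall (a b : algorithm) (la lb : 'cV[R]_m) (mua mub : 'cV[R]_p),
    produces runs a P x la mua -> KKT P x la mua ->
    produces runs b P x lb mub -> KKT P x lb mub ->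
    Psi T la = Psi T lb.
Proof.
move=> C2 _ _ licq _ a b la lb mua mub _ kkta _ kktb.
by have [->] := KKT_multipliers_unique C2 licq kkta kktb.
Qed.
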